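(* Let $\alpha_0+2\alpha_1+3\alpha_2=1$ and consider the system $$\frac{dx}{dt}=4x^3y+2(\alpha_0+2\alpha_1)x^2+2tx+1,$$ $$\frac{dy}{dt}=-6x^2y^2-4(\alpha_0+2\alpha_1)xy-2ty-2\alpha_1(\alpha_0+\alpha_1).$$ Make the change of parameters and variables $$\alpha_0=\frac{1}{4\varepsilon^6},\quad\alpha_1=A_0,\quad\alpha_2=\frac{4A_1\varepsilon^6-1}{12\varepsilon^6},\quad t=-\frac{1-\varepsilon^4T}{\sqrt2\,\varepsilon^3},$$ $$x=\frac{\sqrt2\,\varepsilon^3X}{2\varepsilon^2+X},\quad y=\frac{(X+2\varepsilon^2)(XY+2\varepsilon^2Y+A_0)}{2\sqrt2\,\varepsilon^5}$$ from $\alpha_0,\alpha_1,\alpha_2,t,x,y$ to $A_0,A_1,\varepsilon,T,X,Y$. Then the system can be written in the new variables $T,X,Y$ and parameters $A_0,A_1,\varepsilon$ as a Hamiltonian system, and as $\varepsilon\to0$ this new system tends to the system $$\frac{dX}{dT}=X^4Y+A_0X^3+\frac T2X^2+1,\qquad \frac{dY}{dT}=-2X^3Y^2-3A_0X^2Y-TXY-A_0^2X-\frac{A_0T}{2},$$ with $2A_0+A_1=1$.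
   Context: A Hamiltonian system in $(X,Y)$ with independent variable $T$ is one of the form $dX/dT=\partial K/\partial Y$, $dY/dT=-\partial K/\partial X$ for a function $K(X,Y,T)$. ''Tends to'' means that the right-hand sides of the equations, as rational functions of $X,Y,T$ (with $A_i$ fixed), converge as $\varepsilon\to0$ to the right-hand sides of the limit system. *)

(* Defs.v *)
From HB Require Import structures.
From mathcomp Require Import all_boot all_order all_algebra.
From mathcomp Require Import all_classical all_reals all_analysis.
(* The notations of mpoly clash with those of all_analysis. *)
From mathcomp Require Import (canonicals, coercions) mpoly.

Set Implicit Arguments.
Unset Strict Implicit.
Unset Printing Implicit Defensive.

Import Order.TTheory GRing.Theory Num.Theory.
Import numFieldNormedType.Exports.
Local Open Scope classical_set_scope.
Local Open Scope ring_scope.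

Section Painleve.
(* Both the real and the complex numbers are instances; limits and derivatives
   are those of the topology given by the norm of K. *)
Variable K : numFieldType.
(* The square root of 2 is a parameter, since a numFieldType need not have
   one. *)
Variable sqrt2 : K.
Implicit Types (a A eps t x y T X Y : K).

Definition rhs_x a0 a1 t x y : K :=
  4 * x ^+ 3 * y + 2 * (a0 + 2 * a1) * x ^+ 2 + 2 * t * x + 1.

Definition rhs_y a0 a1 t x y : K :=
  - 6 * x ^+ 2 * y ^+ 2 - 4 * (a0 + 2 * a1) * x * y - 2 * t * y
  - 2 * a1 * (a0 + a1).

(* The functions u, v of s satisfy, at the point s, the system
   du/ds = f(s, u, v), dv/ds = g(s, u, v). *)
Definition solves_at (f g : K -> K -> K -> K) (u v : K -> K) (s : K) : Prop :=
  is_derive s (1 : K) u (f s (u s) (v s)) /\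
  is_derive s (1 : K) v (g s (u s) (v s)).

Definition alpha0 eps : K := 1 / (4 * eps ^+ 6).
Definition alpha1 A0 : K := A0.
Definition alpha2 A1 eps : K := (4 * A1 * eps ^+ 6 - 1) / (12 * eps ^+ 6).

Definition t_of eps T : K := - ((1 - eps ^+ 4 * T) / (sqrt2 * eps ^+ 3)).
Definition x_of eps X : K := sqrt2 * eps ^+ 3 * X / (2 * eps ^+ 2 + X).
Definition y_of A0 eps X Y : K :=
  (X + 2 * eps ^+ 2) * (X * Y + 2 * eps ^+ 2 * Y + A0)
  / (2 * sqrt2 * eps ^+ 5).

(* x(t), y(t) and X(T), Y(T) correspond to each other for T near T0, away
   from the pole X = - 2 eps^2 of the change of variables. *)
Definition corresponds_near A0 eps (x y X Y : K -> K) (T0 : K) : Prop :=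
  \forall T \near T0,
    [/\ 2 * eps ^+ 2 + X T != 0,
        x (t_of eps T) = x_of eps (X T) &
        y (t_of eps T) = y_of A0 eps (X T) (Y T)].

(* The change of variables turns the system with right-hand sides f, g in
   (t, x, y) into the one with right-hand sides F, G in (T, X, Y).  No
   differentiability of the four functions is presupposed. *)
Definition rewrites_as A0 eps (f g F G : K -> K -> K -> K) : Prop :=
  forall (x y X Y : K -> K) (T0 : K),
    corresponds_near A0 eps x y X Y T0 ->
    (solves_at f g x y (t_of eps T0) <-> solves_at F G X Y T0).

(* dX/dT = F(T, X, Y), dY/dT = G(T, X, Y) is the Hamiltonian system of H,
   all functions taking their arguments in the order T, X, Y. *)
Definition hamiltonian_system (H F G : K -> K -> K -> K) : Prop :=
  forall T X Y : K,
    is_derive Y (1 : K) (fun Y' : K => H T X Y') (F T X Y) /\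
    is_derive X (1 : K) (fun X' : K => H T X' Y) (- G T X Y).

Definition point3 T X Y : 'I_3 -> K := fun i => nth 0 [:: T; X; Y] i.

(* K is infinite, so the values of f where Q does not vanish determine P / Q
   in the field of rational functions. *)
Definition represents (P Q : mpoly.mpoly 3 K) (f : K -> K -> K -> K) : Prop :=
  Q != 0 /\
  forall T X Y : K, mpoly.meval (point3 T X Y) Q != 0 ->
    f T X Y = mpoly.meval (point3 T X Y) P / mpoly.meval (point3 T X Y) Q.

(* Convergence of F eps to F0 as rational functions of (T, X, Y) when eps
   tends to 0 with eps != 0: numerators and denominators of bounded degree
   converge coefficientwise. *)
Definition tends_to_ratfun (F : K -> K -> K -> K -> K) (F0 : K -> K -> K -> K)
    : Prop :=
  exists (d : nat) (P Q : K -> mpoly.mpoly 3 K) (P0 Q0 : mpoly.mpoly 3 K),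
    [/\ forall eps, eps != 0 ->
          [/\ represents (P eps) (Q eps) (F eps),
              (mpoly.msize (P eps) <= d)%N & (mpoly.msize (Q eps) <= d)%N],
        represents P0 Q0 F0 &
        forall m,
          (mpoly.mcoeff m (P eps) @[eps --> (0 : K)^'] --> mpoly.mcoeff m P0) /\
          (mpoly.mcoeff m (Q eps) @[eps --> (0 : K)^'] --> mpoly.mcoeff m Q0)].

(* Convergence as rational functions alone says nothing at the zeros of the
   denominators, so convergence at every point is required as well. *)
Definition tends_to (F : K -> K -> K -> K -> K) (F0 : K -> K -> K -> K)
    : Prop :=
  tends_to_ratfun F F0 /\
  forall T X Y : K, F eps T X Y @[eps --> (0 : K)^'] --> F0 T X Y.

Definition lim_X A0 T X Y : K :=
  X ^+ 4 * Y + A0 * X ^+ 3 + T / 2 * X ^+ 2 + 1.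

Definition lim_Y A0 T X Y : K :=
  - 2 * X ^+ 3 * Y ^+ 2 - 3 * A0 * X ^+ 2 * Y - T * X * Y - A0 ^+ 2 * X
  - A0 * T / 2.

End Painleve.

(* Main.v *)
(** Put [u = X + 2 eps^2].  Then [x = sqrt2 eps^3 X / u] and
    [y = u (u Y + A0) / (2 sqrt2 eps^5)] satisfy [dx /\ dy = dX /\ dY], while
    [dt = (eps / sqrt2) dT]; hence the new system is Hamiltonian.
    Its singular powers of [eps] cancel and its right-hand sides are those of the limit system plus [eps^2] times
    polynomials independent of [eps]. *)
Require Import Defs.
From mathcomp Require Import all_boot all_order all_algebra.
From mathcomp Require Import all_classical all_reals all_analysis.
From mathcomp Require Import ring.
From mathcomp Require Import (canonicals, coercions) mpoly.

Import Order.TTheory GRing.Theory Num.Theory.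
Import numFieldNormedType.Exports.
Local Open Scope ring_scope.

(** * Derivatives in one variable and under the change of time *)

Lemma is_derive1_chain {K : numFieldType} {f g : K -> K} {x df dg : K} :
  is_derive (g x) (1 : K) f df -> is_derive x (1 : K) g dg ->
  is_derive x (1 : K) (fun z => f (g z)) (df * dg).
Proof.
move=> [fd fE] [gd gE]; split.
  apply/derivable1_diffP; apply: (@differentiable_comp _ _ _ _ g f);
  exact/derivable1_diffP.
have /derivable1_diffP fd' := fd; have /derivable1_diffP gd' := gd.
rewrite -derive1E derive1E'; last exact: (@differentiable_comp _ _ _ _ g f).
rewrite (@diff_comp _ _ _ _ g f) //= -fE -gE -!derive1E !derive1E' //.
(* The differential is linear and ['d g x 1] is a scalar, so composing differentials multiplies
   derivatives. *)
have dfZ : 'd f (g x) ('d g x 1 *: 1) = 'd g x 1 *: 'd f (g x) 1 := linearZ _ _.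
by rewrite mulrC -[RHS]dfZ [_ *: 1]mulr1.
Qed.

Lemma is_derive1_inv {K : numFieldType} {f : K -> K} {x df : K} :
  f x != 0 -> is_derive x (1 : K) f df ->
  is_derive x (1 : K) (fun z => (f z)^-1) (- (f x) ^- 2 * df).
Proof.
move=> fx0 [fd <-]; split; first exact: derivableV.
by rewrite deriveV.
Qed.

Lemma is_derive_t_of (K : numFieldType) (s e T0 : K) :
  s != 0 -> e != 0 -> is_derive T0 (1 : K) (t_of s e) (e / s).
Proof.
move=> s0 e0; rewrite /t_of; apply: is_derive_eq.
by rewrite /GRing.scale /=; field; rewrite s0 e0.
Qed.

(** The function is the inverse of [t_of s e], found by solving for [T]. *)
Lemma is_derive_t_of_inv (K : numFieldType) (s e t0 : K) :
  s != 0 -> e != 0 ->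
  is_derive t0 (1 : K) (fun t : K => (1 + s * e ^+ 3 * t) / e ^+ 4) (s / e).
Proof.
move=> s0 e0; apply: is_derive_eq.
by rewrite /GRing.scale /=; field.
Qed.

(** The time change is an affine bijection, so differentiability passes both ways and neither side
    has to presuppose it. *)
Lemma is_derive_comp_t_of (K : numFieldType) (s e T0 a : K) (x : K -> K) :
  s != 0 -> e != 0 ->
  is_derive (t_of s e T0) (1 : K) x a <->
  is_derive T0 (1 : K) (fun T => x (t_of s e T)) (a * (e / s)).
Proof.
move=> s0 e0; split=> dx.
  exact: is_derive1_chain dx (is_derive_t_of _ _ _ _ s0 e0).
pose r (t : K) := (1 + s * e ^+ 3 * t) / e ^+ 4.
have tK t : t_of s e (r t) = t by rewrite /t_of /r; field; rewrite s0 e0.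
have rK : r (t_of s e T0) = T0 by rewrite /t_of /r; field; rewrite s0 e0.
(* For the converse, [x] is recovered from its composite with [t_of] by composing with the inverse
   [r]. *)
have -> : x = (fun t => x (t_of s e (r t))) by apply/funext => t; rewrite tK.
have dr := is_derive_t_of_inv _ _ _ (t_of s e T0) s0 e0.
rewrite -rK in dx; apply: (is_derive_eq (is_derive1_chain dx dr)).
by field; rewrite s0 e0.
Qed.

(** Values and coefficients alike have the form [a + eps ^+ 2 * b], continuous in [eps], and 1
    serves as denominator throughout. *)
Lemma tends_to_add_sqr (K : numFieldType) (P0 P1 : mpoly.mpoly 3 K)
    (F0 F1 : K -> K -> K -> K) :
  (forall T X Y, mpoly.meval (point3 T X Y) P0 = F0 T X Y) ->
  (forall T X Y, mpoly.meval (point3 T X Y) P1 = F1 T X Y) ->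
  tends_to (fun eps T X Y => F0 T X Y + eps ^+ 2 * F1 T X Y) F0.
Proof.
move=> P0E P1E.
have lim (a b : K) : (a + eps ^+ 2 * b @[eps --> (0 : K)^'] --> a)%classic.
  have c : {for (0 : K), continuous (fun eps : K => a + eps ^+ 2 * b)}.
    apply: differentiable_continuous; apply/derivable1_diffP.
    by apply: ex_derive.
  have /continuous_withinNx := c.
  by rewrite /= expr0n mul0r addr0.
split; last by move=> T X Y; exact: lim.
(* A size bound independent of [eps]: the first two sizes bound the numerators, the last one the
   denominator 1. *)
exists (maxn (maxn (mpoly.msize P0) (mpoly.msize P1))
             (mpoly.msize (1 : mpoly.mpoly 3 K))).
exists (fun eps => P0 + eps ^+ 2 *: P1), (fun=> 1), P0, 1.
have rep P f : (forall T X Y : K, mpoly.meval (point3 T X Y) P = f T X Y) ->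
    represents P 1 f.
  by move=> PE; split=> [|T X Y _]; rewrite ?oner_neq0 // PE mpoly.meval1 divr1.
split.
- move=> e _; split.
  + by apply: rep => T X Y; rewrite mpoly.mevalD mpoly.mevalZ P0E P1E.
  + rewrite leq_max (leq_trans (mpoly.msizeD_le _ _)) // geq_max !leq_max.
    by rewrite leqnn mpoly.msizeZ_le orbT.
  + by rewrite leq_max leqnn orbT.
- exact: rep.
- move=> m; split; last exact: cvg_cst.
  under eq_fun do rewrite mpoly.mcoeffD mpoly.mcoeffZ.
  exact: lim.
Qed.

(** * The Hamiltonian system in the new variables *)

Section RescaledSystem.
Variables (K : numFieldType) (A0 : K).
Implicit Types (e T X Y : K).

(** [rescaled_X1] and [rescaled_Y1] form the Hamiltonian vector field of the coefficient of [e ^+ 2]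
    in [rescaled_H]. *)
Definition rescaled_X1 T X Y : K := 2 * X ^+ 3 * Y + 2 * A0 * X ^+ 2 + T * X.

Definition rescaled_Y1 T X Y : K :=
  - (3 * X ^+ 2 * Y ^+ 2 + 4 * A0 * X * Y + T * Y + A0 ^+ 2).

Definition rescaled_X e T X Y : K :=
  lim_X A0 T X Y + e ^+ 2 * rescaled_X1 T X Y.

Definition rescaled_Y e T X Y : K :=
  lim_Y A0 T X Y + e ^+ 2 * rescaled_Y1 T X Y.

(** With a0, a1 for the old parameters, this is the old Hamiltonian 2x^3y^2 + 2(a0 + 2a1)x^2y + 2txy
    + y + 2a1(a0 + a1)x times dt/dT = e/s, less the constant A0/(2e^2). For u = X + 2e^2 the terms
    in e^-4 combine to (uY + A0)(X - u)^2/(4e^4u), and (X - u)^2 = 4e^4. *)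
Definition rescaled_H e T X Y : K :=
  X ^+ 4 * Y ^+ 2 / 2 + (A0 * X ^+ 3 + T / 2 * X ^+ 2 + 1) * Y
  + A0 ^+ 2 * X ^+ 2 / 2 + A0 * T / 2 * X
  + e ^+ 2 * (X ^+ 3 * Y ^+ 2 + 2 * A0 * X ^+ 2 * Y + T * X * Y + A0 ^+ 2 * X).

Lemma rescaled_hamiltonian e :
  hamiltonian_system (rescaled_H e) (rescaled_X e) (rescaled_Y e).
Proof.
move=> T X Y; rewrite /rescaled_H /rescaled_X /rescaled_Y /lim_X /lim_Y.
rewrite /rescaled_X1 /rescaled_Y1.
by split; apply: is_derive_eq; rewrite /GRing.scale /=; field.
Qed.

Let var i : mpoly.mpoly 3 K := mpoly.mpolyX K (mpoly.mnm1 i).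
Let cst c : mpoly.mpoly 3 K := mpoly.mpolyC 3 c.

Lemma meval_point3 T X Y :
  let ev := mpoly.meval (point3 T X Y) in
  [/\ ev (var (inord 0)) = T, ev (var (inord 1)) = X & ev (var (inord 2)) = Y].
Proof. by rewrite /= !mpoly.mevalXU /point3 !inordK. Qed.

Lemma tends_to_rescaled_X : tends_to rescaled_X (lim_X A0).
Proof.
pose T := var (inord 0); pose X := var (inord 1); pose Y := var (inord 2).
(* The factor 1/2 enters as a constant polynomial, which [mevalC] evaluates. *)
apply: (@tends_to_add_sqr K
  (X ^+ 4 * Y + cst A0 * X ^+ 3 + T * cst 2^-1 * X ^+ 2 + 1)
  (2 * X ^+ 3 * Y + 2 * cst A0 * X ^+ 2 + T * X)) => t x y.
all: have [ET EX EY] := meval_point3 t x y.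
- rewrite /lim_X !(rmorphD, rmorph1, rmorphXn, rmorphM) /=.
  by rewrite ET EX EY !mpoly.mevalC.
- rewrite /rescaled_X1 !(rmorphD, rmorph_nat, rmorphXn, rmorphM) /=.
  by rewrite ET EX EY !mpoly.mevalC.
Qed.

Lemma tends_to_rescaled_Y : tends_to rescaled_Y (lim_Y A0).
Proof.
pose T := var (inord 0); pose X := var (inord 1); pose Y := var (inord 2).
apply: (@tends_to_add_sqr K
  (- 2 * X ^+ 3 * Y ^+ 2 - 3 * cst A0 * X ^+ 2 * Y - T * X * Y
   - cst A0 ^+ 2 * X - cst A0 * T * cst 2^-1)
  (- (3 * X ^+ 2 * Y ^+ 2 + 4 * cst A0 * X * Y + T * Y + cst A0 ^+ 2)))
  => t x y.
all: have [ET EX EY] := meval_point3 t x y.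
- rewrite /lim_Y !(rmorphB, rmorphN, rmorph_nat, rmorphXn, rmorphM) /=.
  by rewrite ET EX EY !mpoly.mevalC.
- rewrite /rescaled_Y1 !(rmorphN, rmorphD, rmorph_nat, rmorphXn, rmorphM) /=.
  by rewrite ET EX EY !mpoly.mevalC.
Qed.

(** The change of variables is invertible off its pole. Each pair of functions is therefore given
    near [T0] by rational formulas in the other, and differentiating these formulas transfers the
    equations. *)
Lemma rewrites_as_rescaled (s e : K) :
  s ^+ 2 = 2 -> e != 0 ->
  rewrites_as s A0 e (rhs_x (alpha0 e) (alpha1 A0))
    (rhs_y (alpha0 e) (alpha1 A0)) (rescaled_X e) (rescaled_Y e).
Proof.
move=> s2 e0 x y X Y T0 near_corr.
have s0 : s != 0.
  by apply: contra_eq_neq s2 => ->; rewrite expr0n /= eq_sym pnatr_eq0.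
have [u0 xE yE] := nbhs_singleton near_corr.
(* This shows that [s * e ^+ 3 - x], the denominator of the inverse change, equals [2 * s * e ^+ 5]
   over [2 * e ^+ 2 + X] and so never vanishes. *)
have numE w : s * e ^+ 3 * (2 * e ^+ 2 + w) - s * e ^+ 3 * w = 2 * s * e ^+ 5.
  by ring.
have num0 : 2 * s * e ^+ 5 != 0 by rewrite !mulf_neq0 ?expf_neq0 ?pnatr_eq0.
pose xT T := x (t_of s e T); pose yT T := y (t_of s e T).
(* Solving [x_of] for [X], and below [y_of] for [Y]; equality on a neighbourhood lets derivatives be
   compared. *)
have nearX : \forall T \near T0, 2 * e ^+ 2 * xT T / (s * e ^+ 3 - xT T) = X T.
  apply: filterS near_corr => T [u xTE _].
  rewrite /xT xTE /x_of.
  by field: s2; rewrite u numE num0.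
have nearY : \forall T \near T0,
    (2 * s * e ^+ 5 * yT T / (2 * e ^+ 2 + X T) - A0) / (2 * e ^+ 2 + X T)
    = Y T.
  apply: filterS near_corr => T [u _ yTE].
  rewrite /yT yTE /y_of.
  by field; rewrite u e0 s0.
have nearx : \forall T \near T0, x_of s e (X T) = xT T.
  by apply: filterS near_corr => T [].
have neary : \forall T \near T0, y_of s A0 e (X T) (Y T) = yT T.
  by apply: filterS near_corr => T [].
rewrite /solves_at.
pose f := rhs_x (alpha0 e) (alpha1 A0) (t_of s e T0) (xT T0) (yT T0).
pose g := rhs_y (alpha0 e) (alpha1 A0) (t_of s e T0) (xT T0) (yT T0).
have x_xT : is_derive (t_of s e T0) (1 : K) x f <->
    is_derive T0 (1 : K) xT (f * (e / s)).
  exact: is_derive_comp_t_of.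
have y_yT : is_derive (t_of s e T0) (1 : K) y g <->
    is_derive T0 (1 : K) yT (g * (e / s)).
  exact: is_derive_comp_t_of.
(* Both [x_of] and the formula for [Y] divide by [2 * e ^+ 2 + X T]. *)
have dinvU a : is_derive T0 (1 : K) X a ->
    is_derive T0 (1 : K) (fun T => (2 * e ^+ 2 + X T)^-1)
      (- (2 * e ^+ 2 + X T0) ^- 2 * a).
  move=> dX; apply: (is_derive1_inv (f := fun T => 2 * e ^+ 2 + X T) u0).
  by apply: is_derive_eq; rewrite add0r.
split=> -[].
- move=> /x_xT dx /y_yT dy.
  have v0 : s * e ^+ 3 - xT T0 != 0.
    have -> : s * e ^+ 3 - xT T0 = 2 * s * e ^+ 5 / (2 * e ^+ 2 + X T0).
      by rewrite /xT xE /x_of; field.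
    by rewrite mulf_neq0 ?invr_neq0.
  have dV : is_derive T0 (1 : K) (fun T => s * e ^+ 3 - xT T) (- (f * (e / s))).
    by apply: is_derive_eq; rewrite sub0r.
  have dV' := is_derive1_inv (f := fun T => s * e ^+ 3 - xT T) v0 dV.
  have dX : is_derive T0 (1 : K) X (rescaled_X e T0 (X T0) (Y T0)).
    apply: near_eq_is_derive nearX _; apply: is_derive_eq.
    rewrite /GRing.scale /= /f /xT /yT xE yE.
    rewrite /x_of /y_of /t_of /rhs_x /alpha0 /alpha1.
    rewrite /rescaled_X /lim_X /rescaled_X1.
    by field: s2; rewrite s0 u0 e0 numE num0.
  split=> //.
  (* The formula for [Y] involves [X] besides [y], so the derivative of [X] had to come first. *)
  have dU' := dinvU _ dX.
  apply: near_eq_is_derive nearY _; apply: is_derive_eq.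
  rewrite /GRing.scale /= /g /xT /yT xE yE.
  rewrite /x_of /y_of /t_of /rhs_y /alpha0 /alpha1.
  rewrite /rescaled_X /lim_X /rescaled_X1 /rescaled_Y /lim_Y /rescaled_Y1.
  by field: s2; rewrite u0 e0 s0.
- move=> dX dY.
  (* Conversely, the direct formulas [x_of] and [y_of] are differentiated in [T]. *)
  split; [apply/x_xT | apply/y_yT].
    apply: near_eq_is_derive nearx _; apply: is_derive_eq.
    rewrite /GRing.scale /= /f /xT /yT xE yE.
    rewrite /x_of /y_of /t_of /rhs_x /alpha0 /alpha1.
    rewrite /rescaled_X /lim_X /rescaled_X1.
    by field: s2; rewrite u0 e0 s0.
  apply: near_eq_is_derive neary _; apply: is_derive_eq.
  rewrite /GRing.scale /= /g /xT /yT xE yE.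
  rewrite /x_of /y_of /t_of /rhs_y /alpha0 /alpha1.
  rewrite /rescaled_X /lim_X /rescaled_X1 /rescaled_Y /lim_Y /rescaled_Y1.
  by field: s2; rewrite u0 e0 s0.
Qed.
End RescaledSystem.

Theorem theorem4p3 (K : numFieldType) (sqrt2 : K)
    (sqrt2_gt0 : 0 < sqrt2) (sqrt2_sq : sqrt2 ^+ 2 = 2) (A0 A1 : K) :
  (forall eps : K, eps != 0 ->
     (alpha0 eps + 2 * alpha1 A0 + 3 * alpha2 A1 eps = 1 <->
      2 * A0 + A1 = 1)) /\
  (2 * A0 + A1 = 1 ->
   exists H F G : K -> K -> K -> K -> K,
     [/\ forall eps : K, eps != 0 ->
           rewrites_as sqrt2 A0 eps
             (rhs_x (alpha0 eps) (alpha1 A0)) (rhs_y (alpha0 eps) (alpha1 A0))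
             (F eps) (G eps),
         forall eps : K, eps != 0 ->
           hamiltonian_system (H eps) (F eps) (G eps),
         tends_to F (lim_X A0) &
         tends_to G (lim_Y A0)]).
Proof.
split=> [e e0 | _].
  (* The term 1/(4e^6) of [alpha0] cancels against the pole of [3 * alpha2]. *)
  have -> : alpha0 e + 2 * alpha1 A0 + 3 * alpha2 A1 e = 2 * A0 + A1.
    by rewrite /alpha0 /alpha1 /alpha2; field.
  by [].
exists (@rescaled_H K A0), (@rescaled_X K A0), (@rescaled_Y K A0); split.
- by move=> e e0; exact: rewrites_as_rescaled.
- by move=> e _; exact: rescaled_hamiltonian.
- exact: tends_to_rescaled_X.
- exact: tends_to_rescaled_Y.
Qed.
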